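(* Let $\lambda$ be a real number, $\alpha>0$, and let $X$ be a degenerate Poisson random variable with parameter $\alpha$. Then for every integer $m\ge0$, $$E\big[(X)_m\big]=\alpha^m(1)_{m,\lambda}\frac{1}{(1+\lambda\alpha)^m}.$$ In particular, $$(1+\lambda\alpha)^m\sum_{k=0}^{m}\mathrm{Bel}_{k,\lambda}(\alpha)S_{1,\lambda}(m,k)=\alpha^m(1)_{m,\lambda}.$$
   Context: The falling factorial is $(x)_0=1$, $(x)_n=x(x-1)\cdots(x-n+1)$; the $\lambda$-falling factorial is $(x)_{0,\lambda}=1$, $(x)_{n,\lambda}=x(x-\lambda)\cdots(x-(n-1)\lambda)$ for $n\ge1$. The degenerate exponential is $e_\lambda^x(t)=\sum_{n\ge0}(x)_{n,\lambda}\frac{t^n}{n!}$ $(=(1+\lambda t)^{x/\lambda})$, $e_\lambda(t)=e_\lambda^1(t)$, $e_\lambda^{-1}(\alpha)=1/e_\lambda(\alpha)$; $\log_\lambda(1+t)=\frac1\lambda((1+t)^\lambda-1)$ (for $\lambda=0$: $e^{xt}$, $\log(1+t)$). Degenerate Stirling numbers of the first kind: $\frac1{k!}(\log_\lambda(1+t))^k=\sum_{n\ge k}S_{1,\lambda}(n,k)\frac{t^n}{n!}$. A degenerate Poisson random variable with parameter $\alpha>0$ is a random variable $X$ with $P\{X=i\}=e_\lambda^{-1}(\alpha)\frac{\alpha^i}{i!}(1)_{i,\lambda}$ for $i=0,1,2,\dots$. Degenerate Bell polynomials: $e_\lambda^{-1}(x)e_\lambda\big(xe_\lambda(t)\big)=\sum_{n\ge0}\mathrm{Bel}_{n,\lambda}(x)\frac{t^n}{n!}$,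 i.e. $\mathrm{Bel}_{n,\lambda}(x)=\frac{1}{e_\lambda(x)}\sum_{k\ge0}\frac{x^k}{k!}(1)_{k,\lambda}(k)_{n,\lambda}$. *)

(* Defs.v *)
From HB Require Import structures.
From mathcomp Require Import all_boot all_order all_algebra.
From mathcomp Require Import all_classical all_reals all_analysis.

Set Implicit Arguments.
Unset Strict Implicit.
Unset Printing Implicit Defensive.

Import Order.TTheory GRing.Theory Num.Theory.
Import numFieldNormedType.Exports.

Local Open Scope classical_set_scope.
Local Open Scope ring_scope.

(* (x)_{n,l} = x (x - l) ... (x - (n-1) l) *)
Definition dfalling (R : realType) (l x : R) (n : nat) : R :=
  \prod_(i < n) (x - i%:R * l).

(* e_l^x(t), as the sum of its defining series; where the series converges
   this is (1 + l t)^(x/l), or exp (x t) when l = 0. *)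
Definition dexp (R : realType) (l x t : R) : R :=
  limn (series (fun n => dfalling l x n * (t ^+ n / n`!%:R))).

Definition dlog (R : realType) (l u : R) : R :=
  if l == 0 then ln u else l^-1 * (u `^ l - 1).

(* S n k = S_{1,l}(n, k): the generating function identity
     (1/k!) (log_l (1 + t))^k = \sum_(n >= k) S n k t^n / n!
   holds for all t in a neighbourhood of 0, which determines S n k for all
   n >= k; the values S n k with n < k are irrelevant. *)
Definition is_dstirling1 (R : realType) (l : R) (S : nat -> nat -> R) : Prop :=
  forall k : nat, \forall t \near (0 : R),
    (fun N => \sum_(k <= n < N) S n k * (t ^+ n / n`!%:R)) @ \oo
      --> (k`!%:R)^-1 * dlog l (1 + t) ^+ k.

(* Bel_{n,l}(x) *)
Definition dbell (R : realType) (l : R) (n : nat) (x : R) : R :=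
  (dexp l 1 x)^-1 *
  limn (series (fun k => x ^+ k / k`!%:R * dfalling l 1 k
                         * dfalling l k%:R n)).

(* X takes its values in nat, so these probabilities sum to 1.  In particular
   a degenerate Poisson variable exists only if all the (1)_{i,l} a ^+ i are
   nonnegative and the series defining e_l(a) converges to a nonzero value. *)
Definition degenerate_poisson (R : realType) (d : measure_display)
    (T : measurableType d) (P : probability T R) (l a : R)
    (X : {RV P >-> nat}) : Prop :=
  forall i : nat,
    P [set w | X w = i] =
    ((dexp l 1 a)^-1 * (a ^+ i / i`!%:R) * dfalling l 1 i)%:E.

(* Main.v *)
(* The weights w_i = alpha^i / i! (1)_{i,lambda} satisfy
   (i + 1) w_{i+1} = alpha (1 - i lambda) w_i. Multiplying by (i)_m and summing
   over i relates consecutive factorial moments M_m = sum_i (i)_m w_i: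
     (1 + lambda alpha) M_{m+1} = alpha (1 - m lambda) M_m,
   and M_0 = e_lambda(alpha), which gives the first formula. For the second,
   f_k = (log_lambda (1 + t))^k / k! satisfies
     (1 + t) f_{k+1}' = f_k + (k + 1) lambda f_{k+1},
   whence S(n+1, k+1) = S(n, k) + ((k + 1) lambda - n) S(n, k+1); by induction
   (x)_m = sum_k S(m, k) (x)_{k,lambda}, and taking expectations turns the
   right-hand side into sum_k S(m, k) Bel_{k,lambda}(alpha). *)
Require Import Defs.
From HB Require Import structures.
From mathcomp Require Import all_boot all_order all_algebra.
From mathcomp Require Import all_classical all_reals all_analysis.
From mathcomp Require Import measurable_realfun.
From mathcomp Require Import ring lra.
Import Order.TTheory GRing.Theory Num.Theory.
Import numFieldNormedType.Exports.
Local Open Scope classical_set_scope.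
Local Open Scope ring_scope.

(** * Power series near 0: differentiation and comparison of coefficients *)

Section PowerSeries.
Context {R : realType}.
Implicit Types (c d : R^nat) (f g : R -> R) (t : R).

(** For [r] strictly between the absolute values of [t] and [K], the series converges absolutely at
    [r], and its shifted terms dominate those of the derived series up to a constant. *)
Lemma is_cvg_pseries_diffs c K t :
  cvgn (pseries c K) -> `|t| < `|K| -> cvgn (pseries (pseries_diffs c) t).
Proof.
move=> cK tK.
pose r := (`|t| + `|K|) / 2.
have [tr rK] : `|t| < r /\ r < `|K| by rewrite /r; split; lra.
have r0 : 0 <= r by rewrite (le_trans _ (ltW tr)).
have /is_cvg_pseries_inside_norm : cvgn (pseries c K) by [].
move=> /(_ r); rewrite ger0_norm// => /(_ rK) cr.
(* Factor r^n.+1 - |t|^n.+1 by r - |t| and bound each term from below. *)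
have n_bound n : n.+1%:R * `|t| ^+ n <= (r - `|t|)^-1 * r ^+ n.+1.
  rewrite ler_pdivlMl ?subr_gt0// mulrC.
  rewrite (@le_trans _ _ (r ^+ n.+1 - `|t| ^+ n.+1))//; last first.
    by rewrite lerBlDr lerDl exprn_ge0.
  rewrite subrXX mulrC ler_wpM2l ?subr_ge0 ?(ltW tr)//.
  rewrite -[n.+1 in leLHS]card_ord mulr_natl -sumr_const ler_sum// => i _.
  have /subnKC {1}<- : (i <= n)%N by rewrite -ltnS.
  rewrite /= exprD mulrC ler_wpM2r ?exprn_ge0//.
  by rewrite lerXn2r ?nnegrE// ltW.
apply: normed_cvg.
apply: (@series_le_cvg _ _
    (fun n => (r - `|t|)^-1 * (`|c n.+1| * r ^+ n.+1))).
- by move=> n /=.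
- move=> n; rewrite mulr_ge0 ?invr_ge0 ?subr_ge0 ?(ltW tr)//.
  by rewrite mulr_ge0 ?exprn_ge0.
- move=> n /=; rewrite /pseries_diffs !normrM normr_nat normrX.
  by rewrite -mulrA mulrCA [leRHS]mulrCA ler_wpM2l.
- apply: is_cvg_seriesZ.
  have /cvg_ex[l crl] := cr.
  apply/cvg_ex; exists (l - `|c 0%N| * r ^+ 0).
  have -> : series (fun n => `|c n.+1| * r ^+ n.+1) =
      (fun n => pseries (fun i => `|c i|) r n.+1 - `|c 0%N| * r ^+ 0).
    apply/funext => n; rewrite /pseries /series/= [in RHS]big_nat_recl//=.
    by rewrite addrC addKr.
  apply: cvgB; last exact: cvg_cst.
  by rewrite (cvg_shiftS (pseries _ r)).
Qed.

Lemma near_pseries_radius c g :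
  (\forall t \near (0 : R), pseries c t @ \oo --> g t) ->
  exists2 r : R, 0 < r & forall t, `|t| < r -> pseries c t @ \oo --> g t.
Proof.
move=> /nbhs_ballP[r /= r0 cg]; exists r => // t tr.
by apply: cg; rewrite /ball/= sub0r normrN.
Qed.

Lemma near0_norm_lt (r : R) : 0 < r -> \forall t \near (0 : R), `|t| < r.
Proof.
move=> r0; apply/nbhs_ballP; exists r => //= t.
by rewrite /ball/= sub0r normrN.
Qed.

Lemma near_pseries_derive c g :
  (\forall t \near (0 : R), pseries c t @ \oo --> g t) ->
  \forall t \near (0 : R), pseries (pseries_diffs c) t @ \oo --> 'D_1 g t.
Proof.
move=> /near_pseries_radius[r r0 cg].
have cvgc t : `|t| < r -> cvgn (pseries c t) by move=> /cg/cvgP.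
near=> t.
(* The series and its first two derived series must converge at one common point; each derivation
   shrinks the radius, hence [r / 2], [r / 4], [r / 8]. *)
have tr : `|t| < r / 8 by near: t; apply: near0_norm_lt; rewrite divr_gt0.
have n2 : `|r / 2| = r / 2 by rewrite gtr0_norm ?divr_gt0.
have n4 : `|r / 4| = r / 4 by rewrite gtr0_norm ?divr_gt0.
have n8 : `|r / 8| = r / 8 by rewrite gtr0_norm ?divr_gt0.
have c2 : cvgn (pseries c (r / 2)) by apply: cvgc; rewrite n2; lra.
have d4 : cvgn (pseries (pseries_diffs c) (r / 4)).
  by apply: is_cvg_pseries_diffs c2 _; rewrite n2 n4; lra.
have dd8 : cvgn (pseries (pseries_diffs (pseries_diffs c)) (r / 8)).
  by apply: is_cvg_pseries_diffs d4 _; rewrite n8 n4; lra.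
have d8 : cvgn (pseries (pseries_diffs c) (r / 8)).
  by apply: is_cvg_pseries_inside d4 _; rewrite n8 n4; lra.
have c8 : cvgn (pseries c (r / 8)) by apply: cvgc; rewrite n8; lra.
have t8 : `|t| < `|r / 8| by rewrite n8.
have cD := pseries_snd_diffs c8 d8 dd8 t8.
have gD : is_derive t 1 g (limn (pseries (pseries_diffs c) t)).
  apply: (near_eq_is_derive _ cD).
  have : \forall s \near t, `|s| < r.
    have : continuous (fun s : R => `|s|) by exact: norm_continuous.
    move=> /(_ t)/cvgr_lt; apply; lra.
  by apply: filterS => s /cg/cvg_lim; apply.
rewrite derive_val.
exact: is_cvg_pseries_inside d8 _.
Unshelve. all: by end_near. Qed.

Lemma near_pseries_mul_derive c g :
  (\forall t \near (0 : R), pseries c t @ \oo --> g t) ->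
  \forall t \near (0 : R),
    pseries (fun n => n%:R * c n) t @ \oo --> t * 'D_1 g t.
Proof.
move=> /near_pseries_derive; apply: filterS => t cg.
have := pseries_diffs_equiv (cvgP _ cg).
rewrite (cvg_lim _ cg)// => /(cvgMl_tmp (a := t)) tcg.
rewrite [pseries _ t](_ : _ =
    fun n => t * [series i%:R * c i * t ^+ i.-1]_i n) //.
apply/funext => n; rewrite /pseries /series/= mulr_sumr.
apply: eq_bigr => -[|i] _; first by rewrite !mul0r mulr0.
by rewrite exprS mulrCA.
Qed.

(** Evaluating at 0 gives [c 0%N = 0]; the derived series vanishes near 0 as well, so induction over
    all such series reaches the higher coefficients. *)
Lemma near_pseries0 c :
  (\forall t \near (0 : R), pseries c t @ \oo --> (0 : R)) -> forall n, c n = 0.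
Proof.
move=> c0 n; elim: n c c0 => [|n ih] c c0.
  have /cvg_lim <- // := nbhs_singleton c0.
  apply/esym; apply: cvg_lim => //.
  (* The partial sum of index 0 is empty; all later ones equal [c 0%N]. *)
  rewrite -cvg_shiftS/= (_ : (fun _ => _) = cst (c 0%N)); first exact: cvg_cst.
  apply/funext => n; rewrite /pseries /series/= big_nat_recl//= expr0 mulr1.
  by rewrite big1 ?addr0// => i _; rewrite expr0n mulr0.
have := near_pseries_derive _ _ c0 => {}c0.
have : pseries_diffs c n = 0.
  by apply: ih; apply: filterS c0 => t; rewrite derive_cst.
by move=> /eqP; rewrite mulf_eq0 pnatr_eq0/= => /eqP.
Qed.

Lemma near_pseriesD c d f g :
  (\forall t \near (0 : R), pseries c t @ \oo --> f t) ->
  (\forall t \near (0 : R), pseries d t @ \oo --> g t) ->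
  \forall t \near (0 : R), pseries (fun n => c n + d n) t @ \oo --> f t + g t.
Proof.
move=> cf dg; near=> t.
have cft : pseries c t @ \oo --> f t by near: t.
have dgt : pseries d t @ \oo --> g t by near: t.
rewrite (_ : pseries _ t = pseries c t \+ pseries d t); first exact: cvgD.
apply/funext => n; rewrite /pseries /series/= -big_split/=.
by apply: eq_bigr => i _; rewrite mulrDl.
Unshelve. all: by end_near. Qed.

Lemma near_pseriesZ c f (a : R) :
  (\forall t \near (0 : R), pseries c t @ \oo --> f t) ->
  \forall t \near (0 : R), pseries (fun n => a * c n) t @ \oo --> a * f t.
Proof.
apply: filterS => t /(cvgMl_tmp (a := a)) acf.
rewrite [pseries _ t](_ : _ = fun n => a * pseries c t n) //.
apply/funext => n; rewrite /pseries /series/= mulr_sumr.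
by apply: eq_bigr => i _; rewrite mulrA.
Qed.

Lemma near_pseries1 :
  \forall t \near (0 : R), pseries (fun n => (n == 0%N)%:R) t @ \oo --> (1 : R).
Proof.
near=> t.
rewrite -cvg_shiftS/= (_ : (fun _ => _) = cst 1); first exact: cvg_cst.
apply/funext => n; rewrite /pseries /series/= big_nat_recl//= expr0 mulr1.
by rewrite big1 ?addr0// => i _; rewrite mul0r.
Unshelve. all: by end_near. Qed.

End PowerSeries.

(** Where the real factor [i%:R - m%:R] is negative, [i ^_ m] is already 0. *)
Lemma ffactS_natr {R : realType} (i m : nat) :
  (i ^_ m.+1)%:R = (i ^_ m)%:R * (i%:R - m%:R) :> R.
Proof.
have [mi|im] := leqP m i; first by rewrite ffactnSr natrM natrB.
by rewrite !ffact_small ?mul0r// ltnW// ltnS ltnW.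
Qed.

Lemma ffact_natr {R : realType} (i m : nat) :
  (i ^_ m)%:R = \prod_(j < m) (i%:R - j%:R) :> R.
Proof.
elim: m => [|m ih]; first by rewrite ffactn0 big_ord0.
by rewrite ffactS_natr big_ord_recr ih.
Qed.

(** * Factorial moments of weights obeying the recurrence *)

Section Moments.
Context {R : realType} {l a c : R} {w : R^nat}.
Hypothesis a_gt0 : 0 < a.
Hypothesis w_ge0 : forall i, 0 <= w i.
Hypothesis w0 : w 0%N = 1.
Hypothesis wS : forall i, i.+1%:R * w i.+1 = a * (1 - i%:R * l) * w i.
Hypothesis w_cvg : series w @ \oo --> c.

(* If l a <= -1, the recurrence makes i w_i nondecreasing, so w dominates a
   multiple of the harmonic series. *)
Lemma add1_mul_gt0 : 0 < 1 + l * a.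
Proof.
rewrite ltNge; apply/negP => la.
have w_ge i : a <= i.+1%:R * w i.+1.
  elim: i => [|i ih]; first by rewrite wS w0 mulr1 mul0r subr0 mulr1.
  apply: (le_trans ih); rewrite [leRHS]wS ler_wpM2r//.
  (* The first two summands are nonnegative, since [1 + l * a <= 0]. *)
  have -> : a * (1 - i.+1%:R * l) =
      a + i.+1%:R * - (1 + l * a) + i.+1%:R by ring.
  by rewrite lerDr addr_ge0 ?mulr_ge0 ?oppr_ge0// ltW.
apply: (@dvg_harmonic R).
apply: (@series_le_cvg _ _ (fun n => a^-1 * w n.+1)).
- by move=> n; exact: harmonic_ge0.
- by move=> n; rewrite mulr_ge0// invr_ge0 ltW.
- by move=> n /=; rewrite ler_pdivlMl// mulrC ler_pdivrMl// mulrC mulrC.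
- apply: is_cvg_seriesZ; apply/cvg_ex; exists (c - w 0%N).
  have -> : series (fun n => w n.+1) = (fun n => series w n.+1 - w 0%N).
    by apply/funext => n; rewrite /series/= [in RHS]big_nat_recl//= addrC addKr.
  by apply: cvgB; [rewrite (cvg_shiftS (series w))|exact: cvg_cst].
Qed.

(** Write [1 - i l] as [(1 - m l) - l (i - m)] and absorb [i - m] into the falling factorial. *)
Lemma series_ffact_rec m N :
  series (fun i => (i ^_ m.+1)%:R * w i) N.+1 =
  a * (1 - m%:R * l) * series (fun i => (i ^_ m)%:R * w i) N -
  l * a * series (fun i => (i ^_ m.+1)%:R * w i) N.
Proof.
rewrite /series/= big_nat_recl//= mul0r add0r !mulr_sumr -sumrB.
apply: eq_bigr => i _.
rewrite ffactSS mulnC natrM -mulrA wS ffactS_natr; ring.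
Qed.

(* Summing the recurrence gives S' N.+1 + l a S' N = a (1 - m l) S N for the
   partial sums S, S' of orders m and m.+1. Since S' is nondecreasing,
   (1 + l a) S' N <= a (1 - m l) S N bounds S', whatever the sign of l. *)
Lemma factorial_moment m :
  series (fun i => (i ^_ m)%:R * w i) @ \oo -->
    c * (a ^+ m * dfalling l 1 m * (1 / (1 + l * a) ^+ m)).
Proof.
have la := add1_mul_gt0.
elim: m => [|m ih].
  rewrite /dfalling big_ord0 !expr0 divr1 !mulr1.
  rewrite [X in series X](_ : _ = w)//.
 by apply/funext => i; rewrite ffactn0 mul1r.
set L := c * _ in ih.
set S := series (fun i => (i ^_ m)%:R * w i) in ih.
set S' := series (fun i => (i ^_ m.+1)%:R * w i).
have S'nd : nondecreasing_seq S'.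
  by apply: nondecreasing_series => i _; rewrite mulr_ge0.
have S'rec N : S' N.+1 = a * (1 - m%:R * l) * S N - l * a * S' N.
  exact: series_ffact_rec.
have aS : (fun N => a * (1 - m%:R * l) * S N) @ \oo --> a * (1 - m%:R * l) * L.
  exact: cvgMl_tmp.
have S'cvg : cvgn S'.
  apply: nondecreasing_is_cvgn => //.
  have /cvg_seq_bounded/bounded_fun_has_ubound[M aSM] :
    cvgn (fun N => a * (1 - m%:R * l) * S N) := cvgP _ aS.
  exists (M / (1 + l * a)) => _ [N _ <-].
  rewrite ler_pdivlMr//.
  apply: (@le_trans _ _ (a * (1 - m%:R * l) * S N)); last first.
    by apply: aSM; exists N.
  have : S' N <= S' N.+1 by exact: S'nd.
  by rewrite S'rec; lra.
(* The limit of [S'rec] is a linear equation for [limn S'], solvable because [1 + l * a] is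
   nonzero. *)
have S'lim : limn S' = a * (1 - m%:R * l) * L - l * a * limn S'.
  have S'1 : (fun N => S' N.+1) @ \oo --> limn S' by rewrite (cvg_shiftS S').
  rewrite -[LHS](cvg_lim _ S'1)//; apply: cvg_lim => //.
  under eq_fun do rewrite S'rec.
  by apply: cvgB => //; exact: cvgMl_tmp.
suff <- : limn S' =
    c * (a ^+ m.+1 * dfalling l 1 m.+1 * (1 / (1 + l * a) ^+ m.+1)).
  exact: S'cvg.
have -> : limn S' = a * (1 - m%:R * l) * L / (1 + l * a).
  apply: (mulIf (lt0r_neq0 la)); rewrite divfK ?gt_eqF//; lra.
rewrite /L /dfalling big_ord_recr/= !exprS; field.
by rewrite expf_neq0 ?lt0r_neq0.
Qed.

(** The new factor [i - k l] splits as [(i - j) + (j - k l)], and [i - j] raises the order of the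
    falling factorial; so [j] must vary in the induction. *)
Lemma is_cvg_dfalling_moment k j :
  cvgn (series (fun i => dfalling l i%:R k * (i ^_ j)%:R * w i)).
Proof.
elim: k j => [|k ih] j.
  apply: cvgP; under [X in series X]eq_fun do rewrite /dfalling big_ord0 mul1r.
  exact: factorial_moment.
have -> : (fun i => dfalling l i%:R k.+1 * (i ^_ j)%:R * w i) =
    (fun i => dfalling l i%:R k * (i ^_ j.+1)%:R * w i) +
    (j%:R - k%:R * l) *: (fun i => dfalling l i%:R k * (i ^_ j)%:R * w i).
  apply/funext => i; rewrite !fctE ffactS_natr /dfalling big_ord_recr /=.
  rewrite /GRing.scale/=; ring.
by apply: is_cvg_seriesD => //; exact: is_cvg_seriesZ.
Qed.

End Moments.

(** * Expectations of functions of an integer-valued random variable *)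

Section Expectation.
Context {d : measure_display} {T : measurableType d} {R : realType}.
Variables (P : probability T R) (X : {RV P >-> nat}).

Lemma ge0_expectation_nat (f : nat -> R) : (forall i, 0 <= f i) ->
  expectation P (fun w => f (X w)) =
  (\sum_(0 <= i <oo) (f i)%:E * P [set w | X w = i])%E.
Proof.
move=> f0; rewrite unlock.
have mF i : measurable [set w | X w = i].
  exact: (measurable_funPTI X (Y := [set i])).
have XT : \bigcup_i [set w | X w = i] = setT.
  by apply/seteqP; split => // w _; exists (X w).
have mf : measurable_fun setT (EFin \o (f \o X)).
  have mfnat : measurable_fun setT (EFin \o f) by [].
  exact: (measurableT_comp mfnat).
rewrite -XT ge0_integral_bigcup//.
- apply: eq_eseriesr => i _.
  transitivity (\int[P]_(w in [set w | X w = i]) (f i)%:E)%E.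
    by apply: eq_integral => w; rewrite inE /= => ->.
  by rewrite integral_cst.
- by rewrite XT.
- by move=> w _; rewrite lee_fin.
- by move=> i j _ _ [w [/= <- <-]].
Qed.

Lemma expectation_nat_cvg (f p : nat -> R) (s : R) : (forall i, 0 <= f i) ->
  (forall i, P [set w | X w = i] = (p i)%:E) ->
  series (fun i => f i * p i) @ \oo --> s ->
  expectation P (fun w => f (X w)) = s%:E.
Proof.
move=> f0 Pp fps; rewrite ge0_expectation_nat//; apply/cvg_lim => //.
rewrite (_ : (fun n => _) = EFin \o series (fun i => f i * p i)).
  by apply: cvg_EFin => //; exact: nearW.
apply/funext => n; rewrite /series/= -sumEFin; apply: eq_bigr => i _.
by rewrite Pp EFinM.
Qed.

(** Obtained from the expectation of the constant 1. *)
Lemma series_law_nat (p : nat -> R) :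
  (forall i, P [set w | X w = i] = (p i)%:E) -> series p @ \oo --> (1 : R).
Proof.
move=> Pp.
have p0 i : 0 <= p i by rewrite -lee_fin -Pp.
have : expectation P (fun w => cst 1 (X w)) = 1%E.
  by rewrite expectation_cst.
rewrite ge0_expectation_nat//.
under eq_eseriesr do rewrite Pp mul1e.
move=> sum1.
have : (fun n => \sum_(0 <= i < n) (p i)%:E)%E @ \oo --> 1%E.
  by rewrite -sum1; apply: is_cvg_nneseries => n _ _; rewrite lee_fin.
under eq_fun do rewrite sumEFin.
by move/fine_cvg.
Qed.

End Expectation.

(** * Degenerate Stirling numbers of the first kind *)

Section Stirling.
Context {R : realType}.
Variables (l : R) (S : nat -> nat -> R).
Hypothesis S_stirling : is_dstirling1 l S.

(* [is_dstirling1] leaves [S n k] unspecified for [n < k]. *)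
Let T n k : R := if (n < k)%N then 0 else S n k.
Let gen k t : R := (k`!%:R)^-1 * dlog l (1 + t) ^+ k.
Let coeff k n : R := T n k / n`!%:R.

(** The derivative [u ^ (l - 1)] is expressed through [dlog] itself, which covers [l = 0] too and
    leads to the differential equation. *)
Lemma is_derive_dlog (u : R) : 0 < u ->
  is_derive u 1 (dlog l) ((1 + l * dlog l u) / u).
Proof.
move=> u0; rewrite /dlog; case: eqVneq => [->|l0].
  by rewrite mul0r addr0 div1r; exact: is_derive1_ln.
have xlD := is_derive1_powR l u0.
have dlogD : is_derive u 1 (fun v => l^-1 * (v `^ l - 1))
    (l^-1 * (l * u `^ (l - 1) - 0)).
  exact: is_deriveZ _ (is_deriveB _ _).
rewrite mulVKf// addrC subrK.
have -> : u `^ l / u = l^-1 * (l * u `^ (l - 1) - 0); last exact: dlogD.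
rewrite subr0 mulrA mulVf// mul1r.
rewrite powRB; last by rewrite (gt_eqF u0) implybT.
by rewrite powRr1// ltW.
Qed.

(* The differential equation of the generating functions, which yields the
   recurrence of the Stirling numbers by comparing coefficients. *)
Lemma is_derive_gen k (t : R) : -1 < t ->
  exists2 D, is_derive t 1 (gen k.+1) D &
    (1 + t) * D = gen k t + k.+1%:R * l * gen k.+1 t.
Proof.
move=> t1; have t1_gt0 : 0 < 1 + t by rewrite -ltrBlDl sub0r.
have dD := is_derive_dlog _ t1_gt0.
have tD : is_derive t 1 (fun s : R => 1 + s) 1.
  have := is_deriveD (is_derive_cst (1 : R) t 1) (is_derive_id t 1).
  by rewrite add0r.
have gD := is_deriveZ k.+1`!%:R^-1 (is_deriveX k.+1 (is_derive1_comp dD tD)).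
have genE : gen k.+1 =
    k.+1`!%:R^-1 \*: ((dlog l \o (fun s : R => 1 + s)) ^+ k.+1).
  by apply/funext => s; rewrite /= exprfctE.
move: gD; rewrite -genE => gD.
eexists; first exact: gD.
rewrite /gen factS natrM exprS; set L := dlog l (1 + t).
rewrite /GRing.scale/= mulr1.
field.
by rewrite nat1r !pnatr_eq0 -lt0n fact_gt0 (gt_eqF t1_gt0).
Qed.

Lemma near_pseries_gen k :
  \forall t \near (0 : R), pseries (coeff k) t @ \oo --> gen k t.
Proof.
apply: filterS (S_stirling k) => t St.
rewrite [pseries _ t](_ : _ =
    fun N => \sum_(k <= n < N) S n k * (t ^+ n / n`!%:R)) //.
apply/funext => N; apply/esym.
rewrite (@big_nat_widenl _ _ _ k 0)// big_mkcond/= /pseries /series/=.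
apply: eq_bigr => n _; rewrite /coeff /T ltnNge.
by case: (k <= n)%N; rewrite /= ?mul0r// mulrCA mulrC.
Qed.

Lemma dstirling1_00 : S 0 0 = 1 /\ forall n, S n.+1 0 = 0.
Proof.
have /near_pseries0 c0 : \forall t \near (0 : R),
    pseries (fun n => coeff 0 n + -1 * (n == 0%N)%:R) t @ \oo --> (0 : R).
  have := near_pseriesD _ _ _ _ (near_pseries_gen 0)
    (near_pseriesZ _ _ (-1) near_pseries1).
  by apply: filterS => t; rewrite /gen fact0 invr1 expr0 !mulr1 subrr.
split=> [|n].
  by have /eqP := c0 0%N; rewrite /coeff /T/= divr1 mulr1 subr_eq0 => /eqP.
have /eqP := c0 n.+1; rewrite /coeff /T/= mulr0 addr0 mulf_eq0 invr_eq0.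
by rewrite pnatr_eq0 -[_`! == _]negbK -lt0n fact_gt0 orbF => /eqP.
Qed.

(** Compares coefficients of [t ^+ n] in the differential equation; in the factor [1 + t], the 1
    contributes [pseries_diffs] and the [t] multiplies the coefficient by [n]. *)
Lemma dstirling1_rec n k :
  T n.+1 k.+1 = T n k + (k.+1%:R * l - n%:R) * T n k.+1.
Proof.
have /near_pseries0/(_ n) : \forall t \near (0 : R),
    pseries (fun n => pseries_diffs (coeff k.+1) n + n%:R * coeff k.+1 n +
      -1 * (coeff k n + k.+1%:R * l * coeff k.+1 n)) t @ \oo --> (0 : R).
  have gk := near_pseries_gen k; have gk1 := near_pseries_gen k.+1.
  have := near_pseriesD _ _ _ _
    (near_pseriesD _ _ _ _ (near_pseries_derive _ _ gk1)
                           (near_pseries_mul_derive _ _ gk1))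
    (near_pseriesZ _ _ (-1) (near_pseriesD _ _ _ _ gk
                              (near_pseriesZ _ _ (k.+1%:R * l) gk1))).
  move=> lim; near=> t.
  have t1 : -1 < t.
    have : `|t| < 1 by near: t; exact: near0_norm_lt.
    by rewrite ltr_norml => /andP[].
  have [D gD] := is_derive_gen k t t1.
  have : (1 + t) * 'D_1 (gen k.+1) t = (1 + t) * D by rewrite derive_val.
  move=> <- DE.
  rewrite [X in _ --> X](_ : _ = 'D_1 (gen k.+1) t + t * 'D_1 (gen k.+1) t +
     -1 * (gen k t + k.+1%:R * l * gen k.+1 t)); first by near: t.
  by rewrite -DE; ring.
have n0 : n`!%:R != 0 :> R by rewrite pnatr_eq0 -lt0n fact_gt0.
have n1 : n.+1%:R != 0 :> R by rewrite pnatr_eq0.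
rewrite /pseries_diffs /coeff factS natrM => /(congr1 (fun x => x * n`!%:R)).
rewrite mul0r => /eqP; rewrite -subr_eq0 => /eqP E.
apply/eqP; rewrite -subr_eq0 -E; apply/eqP; field.
by rewrite n0 nat1r n1.
Unshelve. all: by end_near. Qed.

(** In the induction, [x - m = (x - k l) + (k l - m)] matches the two terms of the recurrence. *)
Lemma falling_dstirling1 m (x : R) :
  \sum_(0 <= k < m.+1) S m k * dfalling l x k = \prod_(i < m) (x - i%:R).
Proof.
have [S00 Sn0] := dstirling1_00.
transitivity (\sum_(0 <= k < m.+1) T m k * dfalling l x k).
  by apply: eq_big_nat => k; rewrite /T ltnS ltnNge => /andP[_ ->].
elim: m => [|m ih].
  by rewrite big_nat1 big_ord0 /T/= S00 /dfalling big_ord0 mulr1.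
rewrite big_ord_recr/= -ih mulr_suml.
have T0 n : T n.+1 0 = 0 by rewrite /T Sn0.
have Tnn n : T n n.+1 = 0 by rewrite /T ltnSn.
have Tm0 : m%:R * T m 0 = 0.
  by case: (m) => [|n]; rewrite ?mul0r// T0 mulr0.
rewrite big_nat_recl//= T0 mul0r add0r.
under eq_bigr do rewrite dstirling1_rec mulrDl.
rewrite big_split/=.
(* An index shift: the top term has [T m m.+1 = 0], the bottom one [m%:R * T m 0 = 0]. *)
have -> : \sum_(0 <= k < m.+1)
      (k.+1%:R * l - m%:R) * T m k.+1 * dfalling l x k.+1 =
    \sum_(0 <= k < m.+1) (k%:R * l - m%:R) * T m k * dfalling l x k.
  rewrite [RHS]big_nat_recl//= [LHS]big_nat_recr//= Tnn mulr0 mul0r addr0.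
  by rewrite mul0r sub0r mulNr Tm0 oppr0 mul0r add0r.
rewrite -big_split/=; apply: eq_bigr => k _.
rewrite /dfalling big_ord_recr/=; ring.
Qed.

End Stirling.

(** * Moments of the degenerate Poisson law and degenerate Bell polynomials *)

Theorem theorem4 (R : realType) (d : measure_display) (T : measurableType d)
    (P : probability T R) (lambda alpha : R) (alpha_gt0 : 0 < alpha)
    (X : {RV P >-> nat}) (poisX : degenerate_poisson lambda alpha X)
    (m : nat) :
  expectation P (fun w => (X w ^_ m)%:R) =
    (alpha ^+ m * dfalling lambda 1 m * (1 / (1 + lambda * alpha) ^+ m))%:E
  /\
  forall S1 : nat -> nat -> R, is_dstirling1 lambda S1 ->
    (1 + lambda * alpha) ^+ m *
      (\sum_(0 <= k < m.+1) dbell lambda k alpha * S1 m k) =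
    alpha ^+ m * dfalling lambda 1 m.
Proof.
pose w i : R := alpha ^+ i / i`!%:R * dfalling lambda 1 i.
set c := dexp lambda 1 alpha.
have Xw i : P [set t | X t = i] = (c^-1 * w i)%:E by rewrite poisX /w !mulrA.
have cw_cvg := series_law_nat P X _ Xw.
have w0 : w 0%N = 1 by rewrite /w /dfalling big_ord0 expr0 fact0 divr1 mulr1.
(* The event [X = 0] has probability [c^-1]. If [c] were 0, then [c^-1] would be 0 by convention and
   the total mass would vanish. *)
have c_gt0 : 0 < c.
  have : 0 <= c^-1.
    by rewrite -[c^-1]mulr1 -w0 -lee_fin -Xw.
  rewrite invr_ge0 le_eqVlt => /predU1P[c0|//].
  have cw_cvg0 : series (fun i => c^-1 * w i) @ \oo --> (0 : R).
    rewrite (_ : series _ = cst 0); first exact: cvg_cst.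
    apply/funext => n; rewrite /series/= big1// => i _.
    by rewrite -c0 invr0 mul0r.
  by move: (oner_neq0 R); rewrite (cvg_unique _ cw_cvg cw_cvg0) ?eqxx.
have w_ge0 i : 0 <= w i.
  have /(pmulr_rge0 (w i)) <- : 0 < c^-1 by rewrite invr_gt0.
  by rewrite -lee_fin -Xw.
have wS i : i.+1%:R * w i.+1 = alpha * (1 - i%:R * lambda) * w i.
  rewrite /w /dfalling big_ord_recr/= factS natrM exprS; field.
  by rewrite nat1r !pnatr_eq0 -lt0n fact_gt0.
(* A [limn] alone does not give convergence; it comes from the total mass 1. *)
have w_cvg : series w @ \oo --> c.
  rewrite (_ : series w = fun n => c * series (fun i => c^-1 * w i) n).
    by rewrite -[X in _ --> X]mulr1; exact: cvgMl_tmp.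
  apply/funext => n; rewrite /series/= mulr_sumr.
  by apply: eq_bigr => i _; rewrite mulVKf// gt_eqF.
have moment := factorial_moment alpha_gt0 w_ge0 w0 wS w_cvg m.
have la_gt0 := add1_mul_gt0 alpha_gt0 w_ge0 w0 wS w_cvg.
split.
  apply: (expectation_nat_cvg P X (fun i => (i ^_ m)%:R) _ _ _ Xw) => //.
  rewrite (_ : series _ =
      fun n => c^-1 * series (fun i => (i ^_ m)%:R * w i) n); last first.
    apply/funext => n; rewrite /series/= mulr_sumr.
    by apply: eq_bigr => i _; rewrite mulrCA.
  rewrite -[X in _ --> X](mulKf (lt0r_neq0 c_gt0)).
  exact: cvgMl_tmp.
move=> S1 S1_stirling.
pose B k := series (fun i => w i * dfalling lambda i%:R k).
have B_cvg k : cvgn (B k).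
  have := is_cvg_dfalling_moment alpha_gt0 w_ge0 w0 wS w_cvg k 0.
  by under eq_fun do rewrite ffactn0 mulr1 mulrC.
have : (fun n => \sum_(0 <= k < m.+1) S1 m k * B k n) @ \oo -->
    \sum_(0 <= k < m.+1) S1 m k * limn (B k).
  by apply: cvg_big => [|k _]; [exact: add_continuous|exact: cvgMl_tmp].
(* The sums are exchanged at finite [n], where the Stirling expansion at [x = i] applies
   termwise. *)
have -> : (fun n => \sum_(0 <= k < m.+1) S1 m k * B k n) =
    series (fun i => (i ^_ m)%:R * w i).
  apply/funext => n; under eq_bigr do rewrite mulr_sumr.
  rewrite exchange_big/=; apply: eq_bigr => i _.
  under eq_bigr do rewrite mulrCA.
  rewrite -mulr_sumr (falling_dstirling1 _ _ S1_stirling) mulrC; congr (_ * _).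
  by rewrite ffact_natr.
move=> /(cvg_unique (@norm_hausdorff _ _) moment) sumE.
have -> : \sum_(0 <= k < m.+1) dbell lambda k alpha * S1 m k =
    c^-1 * \sum_(0 <= k < m.+1) S1 m k * limn (B k).
  by rewrite mulr_sumr; apply: eq_bigr => k _; rewrite mulrC mulrCA.
rewrite -sumE mulKf ?gt_eqF// mulrCA div1r mulfV ?mulr1//.
by rewrite expf_neq0// gt_eqF.
Qed.
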